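(* Consider the decomposable quadratic optimization problem $$\min_{\boldsymbol{x}}\ \sum_{i\in\mathcal{V}}\Big(\tfrac12\boldsymbol{x}_i^T\boldsymbol{\Sigma}_i\boldsymbol{x}_i-\boldsymbol{a}_i^T\boldsymbol{x}_i\Big)\quad\text{s.t. } \boldsymbol{A}_{i|j}\boldsymbol{x}_i+\boldsymbol{A}_{j|i}\boldsymbol{x}_j=\boldsymbol{c}_{ij}\ \ \forall (i,j)\in\mathcal{E}$$ over a tree-structured graph $G=(\mathcal{V},\mathcal{E})$, and let $\boldsymbol{x}^\star$ denote an optimal solution. Fix any root node $r\in\mathcal{V}$, with associated directed graph $\vec{G}=(\mathcal{V},\vec{\mathcal{E}})$. Let the set of matrices $\{\boldsymbol{P}_{ij}\mid (i,j)\in\mathcal{E}\}$ be constructed recursively along the directed edges towards $r$ by $$\boldsymbol{P}_{uv}=\boldsymbol{A}_{u|v}\boldsymbol{\Sigma}_u^{-1}\boldsymbol{A}_{u|v}^T\quad\text{for } [u,v]\in\vec{\mathcal{E}} \text{ with } \mathcal{N}_u=\{v\},$$ where $\boldsymbol{\Sigma}_u$ is assumed to be nonsingular for such $u$, and $$\boldsymbol{P}_{ij}=\boldsymbol{A}_{i|j}\Big(\boldsymbol{\Sigma}_i+\sum_{u\in\mathcal{N}_i\setminus\{j\}}\boldsymbol{A}_{i|u}^T\boldsymbol{P}_{ui}^{-1}\boldsymbol{A}_{i|u}\Big)^{-1}\boldsymbol{A}_{i|j}^T\quad\text{for all other } [i,j]\in\vec{\mathcal{E}},$$ and assume that every matrix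 $\boldsymbol{P}_{ij}$ so constructed is symmetric positive definite. Then, by following the two-stage (forward, then backward) asynchronous PDMM (primal-dual method of multipliers) updating procedure over the tree that is described in the context, the estimate $\hat{\boldsymbol{x}}$ converges to $\boldsymbol{x}^\star$ in finitely many iterations.
   Context: Setting. $G=(\mathcal{V},\mathcal{E})$ is an undirected tree with finite node set $\mathcal{V}=\{1,\dots,m\}$; $\mathcal{N}_i=\{j\mid (i,j)\in\mathcal{E}\}$ is the set of neighbours of $i$. Node $i$ carries $\boldsymbol{x}_i\in\mathbb{R}^{n_i}$, and $\boldsymbol{x}=[\boldsymbol{x}_1^T,\dots,\boldsymbol{x}_m^T]^T$. Each $\boldsymbol{\Sigma}_i\in\mathbb{R}^{n_i\times n_i}$ is symmetric positive semi-definite, $\boldsymbol{a}_i\in\mathbb{R}^{n_i}$, and for each edge $(i,j)\in\mathcal{E}$, $\boldsymbol{A}_{i|j}\in\mathbb{R}^{n_{ij}\times n_i}$, $\boldsymbol{A}_{j|i}\in\mathbb{R}^{n_{ij}\times n_j}$ and $\boldsymbol{c}_{ij}=\boldsymbol{c}_{ji}\in\mathbb{R}^{n_{ij}}$. Write $f_i(\boldsymbol{x}_i)=\frac12\boldsymbol{x}_i^T\boldsymbol{\Sigma}_i\boldsymbol{x}_i-\boldsymbol{a}_i^T\boldsymbol{x}_i$ and $\|\boldsymbol{y}\|_{\boldsymbol{M}}^2=\boldsymbol{y}^T\boldsymbol{M}\boldsymbol{y}$. Standing assumption: the Lagrangian $L(\boldsymbol{x},\boldsymbol{\delta})=\sum_{i\in\mathcal{V}}f_i(\boldsymbol{x}_i)+\sum_{(i,j)\in\mathcal{E}}\boldsymbol{\delta}_{ij}^T(\boldsymbol{c}_{ij}-\boldsymbol{A}_{i|j}\boldsymbol{x}_i-\boldsymbol{A}_{j|i}\boldsymbol{x}_j)$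 has a saddle point $(\boldsymbol{x}^\star,\boldsymbol{\delta}^\star)$; its component $\boldsymbol{x}^\star$ is then an optimal solution. Directed graph. For the root $r$, $\mathrm{dist}(i,r)$ is the number of edges on the path from $i$ to $r$ in the tree, and $\vec{\mathcal{E}}=\{[i,j]\mid (i,j)\in\mathcal{E},\ \mathrm{dist}(j,r)<\mathrm{dist}(i,r)\}$. The matrices $\boldsymbol{P}_{ij}$ carry no direction: $\boldsymbol{P}_{ij}=\boldsymbol{P}_{ji}$. Procedure. $\hat{\boldsymbol{x}}_i$ denotes the estimate at node $i$ and $\hat{\boldsymbol{m}}_{i\rightarrow j}$ the message from node $i$ to node $j$; $\boldsymbol{m}^\star_{i\rightarrow j}$ denotes the fixed (converged) message from $i$ to $j$, i.e. the value assigned to it below. One directed edge (equivalently its tail node $i$), respectively one node, is selected per iteration. Forward computation: select $[i,j]\in\vec{\mathcal{E}}$ when $\hat{\boldsymbol{m}}_{u\rightarrow i}=\boldsymbol{m}^\star_{u\rightarrow i}$ for all $u\in\mathcal{N}_i\setminus\{j\}$ (a vacuous condition if $\mathcal{N}_i=\{j\}$), and set $\hat{\boldsymbol{m}}_{i\rightarrow j}=\boldsymbol{m}^\star_{i\rightarrow j}$ with $$\boldsymbol{m}^\star_{i\rightarrow j}=\boldsymbol{c}_{ij}-2\boldsymbol{A}_{i|j}\Big(\boldsymbol{\Sigma}_i+\sum_{u\in\mathcal{N}_i}\boldsymbol{A}_{i|u}^T\boldsymbol{P}_{iu}^{-1}\boldsymbol{A}_{i|u}\Big)^{-1}\Big(\boldsymbol{a}_i+\sum_{u\in\mathcal{N}_i\setminus\{j\}}\boldsymbol{A}_{i|u}^T\boldsymbol{P}_{iu}^{-1}\boldsymbol{m}^\star_{u\rightarrow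 i}\Big),$$ until all directed edges have been processed. Backward computation: select node $i$ when $\hat{\boldsymbol{m}}_{u\rightarrow i}=\boldsymbol{m}^\star_{u\rightarrow i}$ for all $u\in\mathcal{N}_i$, and set $$\hat{\boldsymbol{x}}_i=\arg\min_{\boldsymbol{x}_i}\Big[f_i(\boldsymbol{x}_i)+\sum_{j\in\mathcal{N}_i}\tfrac12\|\boldsymbol{A}_{i|j}\boldsymbol{x}_i-\boldsymbol{m}^\star_{j\rightarrow i}\|_{\boldsymbol{P}_{ij}^{-1}}^2\Big],$$ $$\hat{\boldsymbol{m}}_{i\rightarrow u}=\boldsymbol{m}^\star_{i\rightarrow u}=\boldsymbol{m}^\star_{u\rightarrow i}+\boldsymbol{c}_{iu}-2\boldsymbol{A}_{i|u}\hat{\boldsymbol{x}}_i\quad\text{for all } u \text{ with } [u,i]\in\vec{\mathcal{E}},$$ until all nodes have been processed. *)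

(* Defs.v *)
From mathcomp Require Import all_boot all_order all_algebra.
From mathcomp Require Import reals.

Set Implicit Arguments.
Unset Strict Implicit.
Unset Printing Implicit Defensive.
Import Order.TTheory GRing.Theory Num.Theory.
Local Open Scope ring_scope.

Definition psdmx (R : realType) (n : nat) (M : 'M[R]_n) : Prop :=
  M^T = M /\ forall x : 'cV[R]_n, 0 <= (x^T *m M *m x) 0 0.

Definition pdmx (R : realType) (n : nat) (M : 'M[R]_n) : Prop :=
  M^T = M /\ forall x : 'cV[R]_n, x != 0 -> 0 < (x^T *m M *m x) 0 0.

Definition wnorm2 (R : realType) (n : nat) (M : 'M[R]_n) (y : 'cV[R]_n) : R :=
  (y^T *m M *m y) 0 0.

(* An undirected edge (i,j) is the two-element set [set i; j].  All edge data
   are indexed by such sets, so that n_ij = n_ji, c_ij = c_ji and P_ij = P_ji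
   hold by construction and need no transport:
     A_{i|j} is  matA q [set i; j] i,   c_ij is  vecc q [set i; j].
   Data attached to sets that are not in [edges] are never used. *)
Record quad_network (R : realType) := QuadNetwork {
  nnodes : nat;
  edges : {set {set 'I_nnodes}};
  ndim : 'I_nnodes -> nat;
  edim : {set 'I_nnodes} -> nat;
  Sigma : forall i, 'M[R]_(ndim i);
  veca : forall i, 'cV[R]_(ndim i);
  matA : forall e i, 'M[R]_(edim e, ndim i);
  vecc : forall e, 'cV[R]_(edim e)
}.

Definition node (R : realType) (q : quad_network R) : finType := 'I_(nnodes q).

Definition adj (R : realType) (q : quad_network R) : rel (node q) :=
  fun i j => [set i; j] \in edges q.

Definition nbr (R : realType) (q : quad_network R) (i : node q) :
  {set node q} := [set j | adj i j].

Definition is_tree (R : realType) (q : quad_network R) : Prop :=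
  [/\ forall e, e \in edges q -> #|e| = 2,
      forall i j : node q, connect (@adj R q) i j
    & forall p : seq (node q), (2 < size p)%N -> ~~ ucycleb (@adj R q) p].

(* Length of a shortest simple path from i to r; in a tree there is exactly
   one simple path from i to r, and this is its number of edges. *)
Definition dist (R : realType) (q : quad_network R) (i r : node q) : nat :=
  find (fun k => [exists p : k.-tuple (node q),
          [&& path (@adj R q) i p, last i p == r & uniq (i :: p)]])
       (iota 0 (nnodes q)).

(* The directed edge [i,j], oriented towards the root r. *)
Definition arc (R : realType) (q : quad_network R) (r i j : node q) : bool :=
  adj i j && (dist j r < dist i r)%N.

Definition point (R : realType) (q : quad_network R) : Type :=
  forall i : node q, 'cV[R]_(ndim i).

Definition multiplier (R : realType) (q : quad_network R) : Type :=
  forall e : {set node q}, 'cV[R]_(edim e).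

Definition metric (R : realType) (q : quad_network R) : Type :=
  forall e : {set node q}, 'M[R]_(edim e).

(* The second index is the sender: m_{i -> j} is  mu [set i; j] i  and
   m_{j -> i} is  mu [set i; j] j. *)
Definition messages (R : realType) (q : quad_network R) : Type :=
  forall e : {set node q}, node q -> 'cV[R]_(edim e).

Definition nodef (R : realType) (q : quad_network R) (i : node q)
    (x : 'cV[R]_(ndim i)) : R :=
  2^-1 * (x^T *m Sigma i *m x) 0 0 - ((veca i)^T *m x) 0 0.

Definition objective (R : realType) (q : quad_network R) (x : point q) : R :=
  \sum_(i : node q) nodef (x i).

Definition feasible (R : realType) (q : quad_network R) (x : point q) : Prop :=
  forall i j : node q, adj i j ->
    matA [set i; j] i *m x i + matA [set i; j] j *m x j = vecc [set i; j].

Definition is_optimal (R : realType) (q : quad_network R) (x : point q) :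
    Prop :=
  feasible x /\ forall y : point q, feasible y -> objective x <= objective y.

Definition lagrangian (R : realType) (q : quad_network R) (x : point q)
    (delta : multiplier q) : R :=
  objective x +
  \sum_(e in edges q)
     ((delta e)^T *m (vecc e - \sum_(i in e) matA e i *m x i)) 0 0.

Definition saddle_point (R : realType) (q : quad_network R) (x : point q)
    (delta : multiplier q) : Prop :=
  (forall delta' : multiplier q, lagrangian x delta' <= lagrangian x delta) /\
  (forall x' : point q, lagrangian x delta <= lagrangian x' delta).

Definition hessian (R : realType) (q : quad_network R) (P : metric q)
    (i : node q) (S : {set node q}) : 'M[R]_(ndim i) :=
  Sigma i +
  \sum_(u in S)
     (matA [set i; u] i)^T *m invmx (P [set i; u]) *m matA [set i; u] i.

(* Since invmx is total, the existence of each inverse taken in the recursion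
   is stated explicitly. *)
Definition recursive_metric (R : realType) (q : quad_network R) (r : node q)
    (P : metric q) : Prop :=
  (forall u v : node q, arc r u v -> nbr u = [set v] ->
     Sigma u \in unitmx /\
     P [set u; v] =
       matA [set u; v] u *m invmx (Sigma u) *m (matA [set u; v] u)^T) /\
  (forall i j : node q, arc r i j -> nbr i <> [set j] ->
     hessian P i (nbr i :\ j) \in unitmx /\
     P [set i; j] =
       matA [set i; j] i *m invmx (hessian P i (nbr i :\ j))
         *m (matA [set i; j] i)^T).

Definition local_obj (R : realType) (q : quad_network R) (P : metric q)
    (mu : messages q) (i : node q) (x : 'cV[R]_(ndim i)) : R :=
  nodef x +
  \sum_(j in nbr i)
     2^-1 * wnorm2 (invmx (P [set i; j]))
                   (matA [set i; j] i *m x - mu [set i; j] j).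

Definition local_argmin (R : realType) (q : quad_network R) (P : metric q)
    (mu : messages q) (i : node q) (x : 'cV[R]_(ndim i)) : Prop :=
  forall y : 'cV[R]_(ndim i), local_obj P mu x <= local_obj P mu y.

Definition reflected (R : realType) (q : quad_network R) (r : node q)
    (mu : messages q) (i : node q) (x : 'cV[R]_(ndim i)) : Prop :=
  forall u : node q, arc r u i ->
    mu [set i; u] i =
      mu [set i; u] u + vecc [set i; u] - 2%:R *: (matA [set i; u] i *m x).

(* mu is a family of converged messages m^*: towards the root it is given by
   the forward formula, away from the root by the backward formula for some
   local minimiser (there may be several at the root, and then mu is not
   unique). *)
Definition fixed_messages (R : realType) (q : quad_network R) (r : node q)
    (P : metric q) (mu : messages q) : Prop :=
  (forall i j : node q, arc r i j ->
     mu [set i; j] i =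
       vecc [set i; j] -
       2%:R *: (matA [set i; j] i *m invmx (hessian P i (nbr i)) *m
                (veca i +
                 \sum_(u in nbr i :\ j)
                    (matA [set i; u] i)^T *m invmx (P [set i; u])
                      *m mu [set i; u] u))) /\
  (forall i : node q, exists x : 'cV[R]_(ndim i),
     local_argmin P mu x /\ reflected r mu x).

Record state (R : realType) (q : quad_network R) := State {
  xhat : point q;
  mhat : messages q;
  arcs_done : {set node q * node q};
  nodes_done : {set node q}
}.

Definition arcs (R : realType) (q : quad_network R) (r : node q) :
  {set node q * node q} := [set b | arc r b.1 b.2].

Definition forward_step (R : realType) (q : quad_network R) (r : node q)
    (mu : messages q) (i j : node q) (s s' : state q) : Prop :=
  [/\ (i, j) \in arcs r :\: arcs_done s,
      forall u, u \in nbr i :\ j -> mhat s [set i; u] u = mu [set i; u] u,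
      mhat s' [set i; j] i = mu [set i; j] i,
      forall e v, (e, v) <> ([set i; j], i) -> mhat s' e v = mhat s e v
    & [/\ forall v, xhat s' v = xhat s v,
          arcs_done s' = (i, j) |: arcs_done s
        & nodes_done s' = nodes_done s]].

(* The backward stage starts once every directed edge has been processed. *)
Definition backward_step (R : realType) (q : quad_network R) (r : node q)
    (P : metric q) (mu : messages q) (i : node q) (s s' : state q) : Prop :=
  [/\ arcs_done s = arcs r,
      i \notin nodes_done s,
      forall u, u \in nbr i -> mhat s [set i; u] u = mu [set i; u] u,
      [/\ local_argmin P mu (xhat s' i),
          reflected r mu (xhat s' i),
          forall u, arc r u i -> mhat s' [set i; u] i = mu [set i; u] i,
          forall v, v <> i -> xhat s' v = xhat s v
        & forall e v, ~ (v = i /\ exists2 u, arc r u i & e = [set i; u]) ->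
            mhat s' e v = mhat s e v]
    & arcs_done s' = arcs_done s /\ nodes_done s' = i |: nodes_done s].

Definition pdmm_step (R : realType) (q : quad_network R) (r : node q)
    (P : metric q) (mu : messages q) (s s' : state q) : Prop :=
  (exists i j : node q, forward_step r mu i j s s') \/
  (exists i : node q, backward_step r P mu i s s').

(* Maximal runs with arbitrary initial estimates and messages: the state only
   stays put when nothing can be selected. *)
Definition pdmm_run (R : realType) (q : quad_network R) (r : node q)
    (P : metric q) (mu : messages q) (s : nat -> state q) : Prop :=
  [/\ arcs_done (s 0%N) = set0,
      nodes_done (s 0%N) = set0
    & forall k : nat,
        pdmm_step r P mu (s k) (s k.+1) \/
        (~ (exists s' : state q, pdmm_step r P mu (s k) s') /\
         s k.+1 = s k)].

Definition finitely_converges (R : realType) (q : quad_network R)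
    (r : node q) (s : nat -> state q) (x : point q) : Prop :=
  exists N : nat,
    [/\ arcs_done (s N) = arcs r,
        nodes_done (s N) = [set: node q]
      & forall k : nat, (N <= k)%N -> forall i, xhat (s k) i = x i].

(* Main.v *)
Require Import Defs.
From mathcomp Require Import all_boot all_order all_algebra.
From mathcomp Require Import reals.
From mathcomp Require Import lra ring.

(** Write KKT for feasibility together with
    [Sigma_i x_i = a_i + sum_u A_{i|u}^T delta_iu] at every node. The program is
    convex, so a KKT point is optimal, and the objective of a feasible [y]
    exceeds that of a KKT point [x] by half the quadratic form of [Sigma] at
    [y - x] ([kkt_objective]). A saddle point of the Lagrangian is a KKT point
    ([saddle_kkt]). The proof identifies fixed messages with KKT points by the
    dictionary
      [m_{j -> i} = A_{i|j} x_i + P_ij delta_ij],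
    under which the condition [Sigma_i x_i = a_i + ...] becomes stationarity of
    the local objective at [i], whose Hessian is
    [H_i = Sigma_i + sum_u A_{i|u}^T P_iu^-1 A_{i|u}].

    What makes the forward message, computed by [i] before it has heard from
    its parent [j], correct is the choice of the metric. If [H'_i] is [H_i]
    without the term of [j], then [P_ij = A H'_i^-1 A^T] gives
    [H_i (H'_i^-1 A^T) = 2 A^T], hence [2 A H_i^-1 A^T = P_ij]
    ([metric_half]), where [A = A_{i|j}]. Solving the stationarity condition at
    [i] for [x_i], the contribution of the unknown message from [j] to
    [2 A x_i] is therefore exactly [m_{j -> i}], and the forward formula says
      [m_{i -> j} = c_ij - 2 A_{i|j} x_i + m_{j -> i}]  ([forward_formula]).
    The backward formula is the same identity with [i] and [j] exchanged. The
    two together are feasibility along the edge and equality of the two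
    expressions that the dictionary gives for [delta_ij].
    Read in one direction this turns the saddle point into a family of fixed
    messages ([kkt_fixed_messages]); in the other, local minimisers that
    reflect a family of fixed messages form a KKT point ([fixed_point_kkt]).

    It remains to see that a run computes these minimisers. Every step marks
    one more directed edge or node, and until all are marked some step is
    possible: an unprocessed edge farthest from the root has received all it
    needs from the children of its tail, and, once the edges are done, an
    unprocessed node nearest to the root has heard from its parent
    ([step_possible]). So a run stops, with local minimisers at all nodes.

    Finally, if the local minimiser at the root is unique, then [H_r] is
    injective. The difference [d] of two optimal points satisfies
    [Sigma_i d_i = 0] and the homogeneous constraints; going from the leaves to
    the root, [d] vanishes at the children of [i], so [H'_i d_i = 0] and
    [d_i = 0], with [H_r] in the place of [H'_i] at the root
    ([flat_tangent_eq0]). Thus the optimal point is unique. *)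

Set Implicit Arguments.
Unset Strict Implicit.
Unset Printing Implicit Defensive.
Import Order.TTheory GRing.Theory Num.Theory.
Local Open Scope ring_scope.

Local Notation arc := Defs.arc.

(** * Convex quadratic forms *)

Section QuadraticForms.

Variable R : realType.

Definition dot n (x y : 'cV[R]_n) : R := (x^T *m y) 0 0.

Lemma dotC n (x y : 'cV[R]_n) : dot x y = dot y x.
Proof. by rewrite /dot !mxE; apply: eq_bigr => k _; rewrite !mxE mulrC. Qed.

Lemma dotDr n (x y z : 'cV[R]_n) : dot x (y + z) = dot x y + dot x z.
Proof. by rewrite /dot mulmxDr mxE. Qed.

Lemma dotZr n a (x y : 'cV[R]_n) : dot x (a *: y) = a * dot x y.
Proof. by rewrite /dot -scalemxAr mxE. Qed.

Lemma dotNr n (x y : 'cV[R]_n) : dot x (- y) = - dot x y.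
Proof. by rewrite -scaleN1r dotZr mulN1r. Qed.

Lemma dot0r n (x : 'cV[R]_n) : dot x 0 = 0.
Proof. by rewrite /dot mulmx0 mxE. Qed.

Lemma dotDl n (x y z : 'cV[R]_n) : dot (x + y) z = dot x z + dot y z.
Proof. by rewrite dotC dotDr !(dotC z). Qed.

Lemma dotNl n (x y : 'cV[R]_n) : dot (- x) y = - dot x y.
Proof. by rewrite dotC dotNr dotC. Qed.

Lemma dotZl n a (x y : 'cV[R]_n) : dot (a *: x) y = a * dot x y.
Proof. by rewrite dotC dotZr dotC. Qed.

Lemma dot_sumr n (I : finType) (A : {pred I}) (x : 'cV[R]_n) (F : I -> 'cV_n) :
  dot x (\sum_(i in A) F i) = \sum_(i in A) dot x (F i).
Proof. exact: (big_morph _ (@dotDr _ x) (dot0r x)). Qed.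

Lemma dot_suml n (I : finType) (A : {pred I}) (x : 'cV[R]_n) (F : I -> 'cV_n) :
  dot (\sum_(i in A) F i) x = \sum_(i in A) dot (F i) x.
Proof. by rewrite dotC dot_sumr; apply: eq_bigr => i _; apply: dotC. Qed.

Lemma dot_mulmxl m n (A : 'M[R]_(m, n)) x y : dot (A *m x) y = dot x (A^T *m y).
Proof. by rewrite /dot trmx_mul mulmxA. Qed.

Lemma dotxx_ge0 n (x : 'cV[R]_n) : 0 <= dot x x.
Proof. by rewrite /dot mxE sumr_ge0 // => k _; rewrite mxE -expr2 sqr_ge0. Qed.

Lemma dotxx_eq0 n (x : 'cV[R]_n) : dot x x = 0 -> x = 0.
Proof.
rewrite /dot mxE => /psumr_eq0P x0; apply/colP => k.
have /eqP := x0 (fun l _ => ltac:(rewrite mxE -expr2; exact: sqr_ge0)) k isT.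
by rewrite !mxE mulf_eq0 orbb => /eqP.
Qed.

Definition quad n (H : 'M[R]_n) (b x : 'cV[R]_n) : R :=
  2^-1 * (x^T *m H *m x) 0 0 - (b^T *m x) 0 0.

Lemma qform_dot n (H : 'M[R]_n) x : (x^T *m H *m x) 0 0 = dot x (H *m x).
Proof. by rewrite /dot mulmxA. Qed.

Lemma quad_expand n (H : 'M[R]_n) b x d : H^T = H ->
  quad H b (x + d) =
    quad H b x + dot (H *m x - b) d + 2^-1 * dot d (H *m d).
Proof.
move=> symH; rewrite /quad !qform_dot -!/(dot _ _).
rewrite mulmxDr !(dotDr, dotDl) dotNl (dotC d (H *m x)) (dotC x (H *m d)).
rewrite dot_mulmxl symH (dotC d (H *m x)); lra.
Qed.

Lemma quad_shift n (H : 'M[R]_n) b b' x :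
  quad H (b + b') x = quad H b x - dot b' x.
Proof. by rewrite /quad -!/(dot _ _) dotDl opprD addrA. Qed.

(** If the gradient [H x - b] were nonzero, a short step against it would
    decrease the form; conversely, [quad_expand] without its linear term has
    only a nonnegative remainder. *)
Lemma quad_min n (H : 'M[R]_n) b x : psdmx H ->
  (forall y, quad H b x <= quad H b y) <-> H *m x = b.
Proof.
move=> [symH posH]; split=> [minx|Hx y]; last first.
  rewrite -(subrK x y) addrC quad_expand // Hx subrr dotC dot0r addr0.
  by rewrite lerDl mulr_ge0 ?invr_ge0 ?ler0n // -qform_dot posH.
apply/eqP; rewrite -subr_eq0; apply/eqP/dotxx_eq0.
set g := H *m x - b; set s := dot g g; set c := dot g (H *m g).
have s0 : 0 <= s by apply: dotxx_ge0.
have c0 : 0 <= c by rewrite /c -qform_dot posH.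
apply/eqP; case: (ltgtP s 0) => // [|sp]; first by rewrite ltNge s0.
(* With t = s / (s + c), the second-order term t^2 c / 2 is at most t s / 2. *)
pose t := s / (s + c).
have tp : 0 < t by rewrite divr_gt0 // ltr_wpDr.
have tc : t * c <= s.
  rewrite /t mulrAC ler_pdivrMr ?ltr_wpDr // ler_pM2l //; lra.
have := minx (x + (- t) *: g); rewrite quad_expand // -/g.
rewrite -scalemxAr !dotZr dotZl -/s -/c => min_t.
have : t * (2^-1 * (t * c) - s) < 0 by rewrite pmulr_rlt0 //; lra.
lra.
Qed.

(** If the form vanishes at [x], then [x] minimises it. *)
Lemma psdmx_kernel n (H : 'M[R]_n) x :
  psdmx H -> dot x (H *m x) = 0 -> H *m x = 0.
Proof.
move=> psdH x0; have [symH posH] := psdH.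
apply/(quad_min 0 x psdH) => y; rewrite /quad -!/(dot _ _) !qform_dot x0.
rewrite ![dot 0 _]dotC !dot0r !subr0 mulr0.
by rewrite mulr_ge0 ?invr_ge0 ?ler0n // -qform_dot posH.
Qed.

Lemma pdmx_psd n (H : 'M[R]_n) : pdmx H -> psdmx H.
Proof.
case=> symH posH; split=> // x.
have [->|/posH/ltW//] := eqVneq x 0.
by rewrite mulmx0 mxE.
Qed.

Lemma psdmxD n (H K : 'M[R]_n) : psdmx H -> psdmx K -> psdmx (H + K).
Proof.
move=> [sH pH] [sK pK]; split=> [|x]; first by rewrite linearD /= sH sK.
by rewrite mulmxDr mulmxDl mxE addr_ge0.
Qed.

Lemma psdmx_congr m n (H : 'M[R]_m) (A : 'M[R]_(m, n)) :
  psdmx H -> psdmx (A^T *m H *m A).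
Proof.
move=> [sH pH]; split=> [|x]; first by rewrite !trmx_mul trmxK sH mulmxA.
by have := pH (A *m x); rewrite trmx_mul !mulmxA.
Qed.

Lemma psdmx_sum n (I : finType) (A : {pred I}) (F : I -> 'M[R]_n) :
  (forall i, i \in A -> psdmx (F i)) -> psdmx (\sum_(i in A) F i).
Proof.
move=> psdF; elim/big_ind: _ => //; last exact: psdmxD.
by split=> [|x]; rewrite ?trmx0 // mulmx0 mul0mx mxE.
Qed.

Lemma unitmx_ker n (H : 'M[R]_n) :
  (forall x : 'cV_n, H *m x = 0 -> x = 0) -> H \in unitmx.
Proof.
move=> kerH; rewrite -unitmx_tr -row_free_unit -kermx_eq0.
apply/eqP/row_matrixP => i; rewrite row0; apply: trmx_inj; rewrite trmx0.
by apply: kerH; rewrite -{1}[H]trmxK -trmx_mul -row_mul mulmx_ker row0 trmx0.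
Qed.

Lemma pdmx_unit n (H : 'M[R]_n) : pdmx H -> H \in unitmx.
Proof.
move=> [_ posH]; apply: unitmx_ker => x Hx; apply/eqP/negPn/negP => /posH.
by rewrite -mulmxA Hx mulmx0 mxE ltxx.
Qed.

Lemma psdmx_inv n (H : 'M[R]_n) : pdmx H -> psdmx (invmx H).
Proof.
move=> pdH; have uH := pdmx_unit pdH; have [sH _] := pdH.
split=> [|x]; first by rewrite trmx_inv sH.
have [_ /(_ (invmx H *m x))] := pdmx_psd pdH.
by rewrite trmx_mul trmx_inv sH -!mulmxA (mulKVmx uH).
Qed.

End QuadraticForms.

(** * Simple paths and distances in a tree *)

Section AcyclicRelations.

Variables (T : finType) (e : rel T).
Hypotheses (e_sym : symmetric e) (e_irr : irreflexive e).
Hypothesis acyclic : forall p : seq T, (2 < size p)%N -> ~~ ucycleb e p.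

Definition avoiding (i : T) : rel T :=
  fun x y => [&& e x y, x != i & y != i].

Lemma connect_avoiding i x p y :
  path e x p -> i \notin x :: p -> y \in x :: p -> connect (avoiding i) x y.
Proof.
move=> e_p i_p y_p; have: path (avoiding i) x p.
  elim: p x e_p i_p {y_p} => //= z p IHp x /andP[exz e_p].
  rewrite !inE !negb_or => /and3P[ix iz ip].
  rewrite /avoiding exz eq_sym ix eq_sym iz /=; apply: IHp => //.
  by rewrite inE negb_or iz.
by move/path_connect; apply.
Qed.

(** Otherwise a simple path from [u] to [v] that avoids [i] closes up through
    [i] to a cycle. *)
Lemma neighbours_separated i u v :
  e i u -> e i v -> connect (avoiding i) u v -> u = v.
Proof.
move=> eiu eiv /connectP[p /shortenP[p' av_p' uniq_p' _] v_last].
apply/eqP; case: p' av_p' uniq_p' v_last => [|w p'] av_p' uniq_p' v_last.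
  by rewrite v_last.
have i_p' : i \notin u :: w :: p'.
  rewrite inE negb_or; apply/andP; split.
    by apply: contraTneq eiu => <-; rewrite e_irr.
  move: (w :: p') (u) av_p' => {uniq_p' v_last}.
  elim=> //= z s IHs x /andP[/and3P[_ _ zi] /IHs i_s].
  by rewrite inE negb_or eq_sym zi.
have /negP[] := acyclic (p := i :: u :: w :: p') isT.
rewrite /ucycleb cons_uniq i_p' uniq_p' andbT /= eiu rcons_path.
have sub_e : subrel (avoiding i) e by move=> x y /and3P[].
have /= /andP[-> ->] := sub_path sub_e av_p'.
by rewrite -[last w p']v_last e_sym eiv.
Qed.

(** At the first vertex [i] where the two paths part, both next vertices reach
    [r] without passing through [i] again. *)
Lemma simple_path_unique i r p p' :
  path e i p -> last i p = r -> uniq (i :: p) ->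
  path e i p' -> last i p' = r -> uniq (i :: p') -> p = p'.
Proof.
elim: p p' i => [|j p IHp] [|j' p'] i //=.
- by move=> _ ir _ _ p'_r /andP[]; rewrite ir -p'_r mem_last.
- by move=> _ p_r /andP[+ _] _ ir _; rewrite ir -p_r mem_last.
case/andP=> eij e_p p_r /and3P[i_p j_p uniq_p].
case/andP=> eij' e_p' p'_r /and3P[i_p' j'_p' uniq_p'].
have jj' : j = j'.
  apply: (neighbours_separated eij eij').
  have av_sym : connect_sym (avoiding i).
    apply: sym_connect_sym => x y; rewrite /avoiding e_sym.
    by congr (_ && _); apply: andbC.
  apply: (@connect_trans _ _ r); last rewrite av_sym.
    by apply: connect_avoiding e_p i_p _; rewrite -p_r mem_last.
  by apply: connect_avoiding e_p' i_p' _; rewrite -p'_r mem_last.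
rewrite -jj' in e_p' p'_r j'_p' *; congr (_ :: _).
by apply: IHp e_p p_r _ e_p' p'_r _; rewrite /= ?j_p ?uniq_p ?j'_p'.
Qed.

(** This is the alternative between the parent of [i] on its path to [r] and a
    child of [i]. *)
Lemma neighbour_on_path i r p u :
  path e i p -> last i p = r -> uniq (i :: p) -> e i u ->
  p = u :: behead p \/ uniq (u :: i :: p).
Proof.
case: p => [|j p] /=.
  move=> _ _ _ eiu; right; rewrite inE !andbT.
  by apply: contraTneq eiu => ->; rewrite e_irr.
case/andP=> eij e_p _ /and3P[i_p j_p uniq_p] eiu.
have [u_p|u_p] := boolP (u \in j :: p).
  left; congr (_ :: _); apply: (neighbours_separated eij eiu).
  exact: connect_avoiding e_p i_p u_p.
right; rewrite i_p j_p uniq_p !andbT inE negb_or u_p andbT.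
by apply: contraTneq eiu => ->; rewrite e_irr.
Qed.

End AcyclicRelations.

Section TreeDistance.

Variables (R : realType) (q : quad_network R).
Hypothesis htree : is_tree q.

Lemma adj_sym : symmetric (@adj R q).
Proof. by move=> i j; rewrite /adj setUC. Qed.

Lemma adj_irr : irreflexive (@adj R q).
Proof.
move=> i; apply/negP => ii; case: htree => card2 _ _.
by have := card2 _ ii; rewrite cards2 eqxx.
Qed.

(** The search in [dist] succeeds at one length only, since the simple path is
    unique. *)
Lemma dist_path (i r : node q) p :
  path (@adj R q) i p -> last i p = r -> uniq (i :: p) -> dist i r = size p.
Proof.
move=> adj_p p_r uniq_p; rewrite /dist.
have size_p : (size p < nnodes q)%N.
  by rewrite -[nnodes q]card_ord -/(size (i :: p)) -(card_uniqP uniq_p) max_card.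
rewrite (eq_find (a2 := pred1 (size p))) => [|k /=].
  rewrite -/(index _ _) -{1}[size p]add0n -(nth_iota 0 0 size_p).
  by rewrite index_uniq ?iota_uniq ?size_iota.
apply/existsP/eqP => [[p' /and3P[adj_p' /eqP p'_r uniq_p']]|->].
  case: htree => _ _ acyc.
  by rewrite (simple_path_unique adj_sym adj_irr acyc adj_p p_r uniq_p
    adj_p' p'_r uniq_p') size_tuple.
by exists (in_tuple p); apply/and3P; split=> //; apply/eqP.
Qed.

Lemma simple_path_exists (i r : node q) : exists p,
  [/\ path (@adj R q) i p, last i p = r & uniq (i :: p)].
Proof.
case: htree => _ /(_ i r)/connectP[p adj_p r_p] _.
by case/shortenP: adj_p r_p => p' adj_p' uniq_p' _ ->; exists p'.
Qed.

Lemma adj_dist (i u r : node q) p : adj i u ->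
  path (@adj R q) i p -> last i p = r -> uniq (i :: p) ->
  p = u :: behead p /\ dist i r = (dist u r).+1 \/ dist u r = (dist i r).+1.
Proof.
move=> iu adj_p p_r uniq_p; have [_ _ acyc] := htree.
case: (neighbour_on_path adj_sym adj_irr acyc adj_p p_r uniq_p iu) => [pu|up].
  left; split=> //; rewrite (dist_path adj_p p_r uniq_p).
  case: p pu adj_p p_r uniq_p => // j p [->] /= adj_p p_r uniq_p.
  congr _.+1; symmetry; apply: dist_path.
  - by case/andP: adj_p.
  - exact: p_r.
  - by case/andP: uniq_p.
right; rewrite (dist_path adj_p p_r uniq_p).
by apply: (dist_path (p := i :: p)); rewrite //= adj_sym iu.
Qed.

Lemma adj_arc (r i j : node q) : adj i j -> arc r i j || arc r j i.
Proof.
move=> ij; have [p [adj_p p_r uniq_p]] := simple_path_exists i r.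
rewrite /arc ij adj_sym ij /=.
by case: (adj_dist ij adj_p p_r uniq_p) => [[_]|] ->; rewrite ltnSn ?orbT.
Qed.

Lemma arc_parent_unique (r i j k : node q) : arc r i j -> arc r i k -> j = k.
Proof.
have [p [adj_p p_r uniq_p]] := simple_path_exists i r.
have head v : arc r i v -> p = v :: behead p.
  case/andP=> iv; case: (adj_dist iv adj_p p_r uniq_p) => [[]//|->].
  by rewrite ltnNge leqnSn.
by move=> /head + /head => -> [].
Qed.

Lemma arc_child (r i j u : node q) : arc r i j -> u \in nbr i :\ j -> arc r u i.
Proof.
move=> ij; rewrite !inE => /andP[uj iu].
case/orP: (adj_arc r iu) => // /(arc_parent_unique ij) ju.
by rewrite ju eqxx in uj.
Qed.

Lemma arc_parent_exists (r i : node q) : i != r -> exists j, arc r i j.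
Proof.
move=> ir; have [[|j p] [adj_p p_r uniq_p]] := simple_path_exists i r.
  by rewrite -p_r eqxx in ir.
have ij : adj i j by case/andP: adj_p.
exists j; rewrite /arc ij /=.
case: (adj_dist ij adj_p p_r uniq_p) => [[_ ->]//|].
rewrite (dist_path adj_p p_r uniq_p) (@dist_path j r p) /=.
- by move/eqP; rewrite -addn2 -{1}[size p]addn0 eqn_add2l.
- by case/andP: adj_p.
- exact: p_r.
- by case/andP: uniq_p.
Qed.

End TreeDistance.

(** * Stationary points of the Lagrangian *)

Section Optimality.

Variables (R : realType) (q : quad_network R).
Hypothesis card_edges : forall e, e \in edges q -> #|e| = 2.
Hypothesis hSigma : forall i : node q, psdmx (Sigma i).

Lemma adj_neq (i j : node q) : adj i j -> i != j.
Proof.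
by move=> /card_edges; rewrite cards2; case: eqP.
Qed.

Lemma big_incident (V : nmodType) (i : node q) (F : {set node q} -> V) :
  \sum_(e in edges q | i \in e) F e = \sum_(u in nbr i) F [set i; u].
Proof.
rewrite -(big_imset F (h := fun u => [set i; u])) /=; last first.
  move=> u v; rewrite !inE => /adj_neq iu /adj_neq iv /setP/(_ u).
  by rewrite !inE eqxx orbT eq_sym (negPf iu) => /esym/eqP.
apply: eq_bigl => e; apply/andP/imsetP => [[ee ie]|[u]].
  have /eqP/cards1P[u eu] : #|e :\ i| = 1.
    by have := card_edges ee; rewrite (cardsD1 i) ie => -[].
  have ei := setD1K ie; rewrite eu in ei.
  by exists u; rewrite -?ei // inE /adj ei.
by rewrite inE => iu ->; split; rewrite // !inE eqxx.
Qed.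

Lemma sum_edge (V : nmodType) (i j : node q) (F : node q -> V) :
  adj i j -> \sum_(k in [set i; j]) F k = F i + F j.
Proof.
by move=> /adj_neq ij; rewrite big_setU1 ?inE //= big_set1.
Qed.

(** Per node, the Lagrangian is a quadratic form whose linear coefficient
    collects the multipliers of the incident edges. *)
Definition tension (delta : multiplier q) (i : node q) : 'cV[R]_(ndim i) :=
  veca i + \sum_(u in nbr i) (matA [set i; u] i)^T *m delta [set i; u].

Lemma lagrangian_nodes (x : point q) (delta : multiplier q) :
  lagrangian x delta =
    \sum_(i : node q) quad (Sigma i) (tension delta i) (x i) +
    \sum_(e in edges q) dot (delta e) (vecc e).
Proof.
have edge_dot e : e \in edges q ->
    dot (delta e) (vecc e - \sum_(i in e) matA e i *m x i) =
    dot (delta e) (vecc e) -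
    \sum_(i in e) dot ((matA e i)^T *m delta e) (x i).
  move=> _; rewrite dotDr dotNr dot_sumr; congr (_ - _).
  by apply: eq_bigr => i _; rewrite dot_mulmxl trmxK.
rewrite /lagrangian -/(dot _ _) (eq_bigr _ edge_dot) sumrB addrCA addrC.
congr (_ + _); rewrite (exchange_big_dep predT) //= -sumrB.
apply: eq_bigr => i _.
rewrite quad_shift dot_suml; congr (_ - _).
exact: (big_incident i (fun e => dot ((matA e i)^T *m delta e) (x i))).
Qed.

Definition kkt (x : point q) (delta : multiplier q) : Prop :=
  feasible x /\ forall i, Sigma i *m x i = tension delta i.

(** The Lagrangian is affine in the multipliers, so it is bounded above in them
    only if the residuals vanish; in each [x_i] it is a convex quadratic form
    up to a constant. *)
Lemma saddle_kkt (x : point q) (delta : multiplier q) :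
  saddle_point x delta -> kkt x delta.
Proof.
case=> max_delta min_x; split=> [i j ij|i].
  (* Moving the multipliers along the residuals adds their squared norm. *)
  pose res (e : {set node q}) := vecc e - \sum_(k in e) matA e k *m x k.
  have res0 : \sum_(e in edges q) dot (res e) (res e) = 0.
    apply/eqP; rewrite eq_le sumr_ge0 ?andbT => [|e _]; last exact: dotxx_ge0.
    have := max_delta (fun e => delta e + res e).
    rewrite /lagrangian lerD2l -subr_le0 -sumrB.
    rewrite (eq_bigr (fun e => dot (res e) (res e))) // => e _.
    by rewrite -!/(dot _ _) dotDl addrC addKr.
  have /(_ _ ij)/dotxx_eq0 := psumr_eq0P (fun e _ => dotxx_ge0 (res e)) res0.
  by rewrite /res sum_edge // => /eqP; rewrite subr_eq0 => /eqP.
apply/(quad_min _ _ (hSigma i)) => y; have := min_x (dfwith x y).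
rewrite !lagrangian_nodes lerD2r (bigD1 i) //= [leRHS](bigD1 i) //= dfwith_in.
rewrite [X in _ <= _ + X](eq_bigr
  (fun k => quad (Sigma k) (tension delta k) (x k))).
  by rewrite lerD2r.
by move=> k ki; rewrite dfwith_out // eq_sym.
Qed.

(** Summed edge by edge instead of node by node, the terms cancel in pairs. The
    edge is an argument of [F] because the two ends of an edge name it by
    different expressions. *)
Lemma sum_antisym (F : {set node q} -> node q -> R) :
  (forall i j, adj i j -> F [set i; j] i + F [set i; j] j = 0) ->
  \sum_(i : node q) \sum_(u in nbr i) F [set i; u] i = 0.
Proof.
move=> F0; under eq_bigr do rewrite -(big_incident _ (F^~ _)).
rewrite (exchange_big_dep (fun e => e \in edges q)) => [|i e _ /andP[] //] /=.
rewrite big1 // => e ee.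
have /cards2P[i [j [ij eE]]] : #|e| == 2 by rewrite card_edges.
rewrite eE in ee *; rewrite (eq_bigl (fun k => k \in [set i; j])); last first.
  by move=> k; rewrite ee.
by rewrite sum_edge // F0.
Qed.

(** At a stationary point the multipliers turn the first-order change of the
    objective into the change of the constraints, which vanishes between
    feasible points. *)
Lemma kkt_objective (x y : point q) delta : kkt x delta -> feasible y ->
  objective y = objective x +
    2^-1 * \sum_(i : node q) dot (y i - x i) (Sigma i *m (y i - x i)).
Proof.
move=> [feas_x stat] feas_y; rewrite /objective mulr_sumr.
pose F (e : {set node q}) i := dot (delta e) (matA e i *m (y i - x i)).
have F0 : \sum_(i : node q) \sum_(u in nbr i) F [set i; u] i = 0.
  apply: sum_antisym => i j ij; rewrite /F -dotDr !mulmxBr addrACA.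
  by rewrite -opprD feas_x // feas_y // subrr dot0r.
rewrite -[RHS]addr0 -[X in _ + X]F0 -!big_split /=; apply: eq_bigr => i _.
have [symS _] := hSigma i.
have -> : nodef (y i) = quad (Sigma i) (veca i) (x i + (y i - x i)).
  by rewrite addrC subrK.
rewrite quad_expand // addrAC; congr (_ + _ + _).
rewrite stat /tension addrC addKr dot_suml.
by apply: eq_bigr => u _; rewrite dot_mulmxl trmxK.
Qed.

Lemma kkt_optimal (x : point q) delta : kkt x delta -> is_optimal x.
Proof.
move=> kkt_x; split=> [|y feas_y]; first by case: kkt_x.
rewrite (kkt_objective kkt_x feas_y) lerDl mulr_ge0 ?invr_ge0 ?ler0n //.
by apply: sumr_ge0 => i _; have [_ posS] := hSigma i; rewrite -qform_dot posS.
Qed.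

Lemma optimal_diff (x y : point q) delta : kkt x delta -> is_optimal y ->
  feasible y /\ forall i, Sigma i *m (y i - x i) = 0.
Proof.
move=> kkt_x [feas_y min_y]; split=> // i.
have dS0 k : true -> 0 <= dot (y k - x k) (Sigma k *m (y k - x k)).
  by have [_ posS] := hSigma k; rewrite -qform_dot posS.
apply: (psdmx_kernel (hSigma i)).
apply: (psumr_eq0P dS0) => //; apply/eqP; rewrite eq_le sumr_ge0 // andbT.
have := min_y x kkt_x.1.
by rewrite (kkt_objective kkt_x feas_y) gerDl pmulr_rle0 // invr_gt0 ltr0n.
Qed.

End Optimality.

(** * Fixed messages *)

Section Messages.

Variables (R : realType) (q : quad_network R) (r : node q) (P : metric q).
Hypothesis htree : is_tree q.
Hypothesis hSigma : forall i : node q, psdmx (Sigma i).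
Hypothesis hPrec : recursive_metric r P.
Hypothesis hPpd : forall e, e \in edges q -> pdmx (P e).

Lemma nbr_edge (i u : node q) : u \in nbr i -> [set i; u] \in edges q.
Proof. by rewrite inE. Qed.

(** At a leaf the sum in [hessian] is empty, so that the two clauses of the
    recursion have one form. *)
Lemma recursive_metric_arc (i j : node q) : arc r i j ->
  hessian P i (nbr i :\ j) \in unitmx /\
  P [set i; j] = matA [set i; j] i *m invmx (hessian P i (nbr i :\ j))
                   *m (matA [set i; j] i)^T.
Proof.
have [leaf inner] := hPrec; move=> ij.
have [nbr_i|/eqP nbr_i] := eqVneq (nbr i) [set j]; last exact: inner.
rewrite nbr_i setDv /hessian big_set0 addr0; exact: leaf.
Qed.

Lemma psdmx_hessian (i : node q) (S : {set node q}) :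
  S \subset nbr i -> psdmx (hessian P i S).
Proof.
move=> /subsetP S_nbr; apply: psdmxD => //; apply: psdmx_sum => u /S_nbr iu.
exact/psdmx_congr/psdmx_inv/hPpd/nbr_edge.
Qed.

Lemma hessian_arc (i j : node q) : arc r i j ->
  hessian P i (nbr i) = hessian P i (nbr i :\ j) +
    (matA [set i; j] i)^T *m invmx (P [set i; j]) *m matA [set i; j] i.
Proof.
case/andP=> ij _; rewrite /hessian (big_setD1 j) ?inE //=.
by rewrite [X in _ + X]addrC addrA.
Qed.

(** With [H = H' + A^T P^-1 A] and [P = A H'^-1 A^T], the product is
    [A^T + A^T P^-1 P]. *)
Lemma hessian_double (i j : node q) : arc r i j ->
  hessian P i (nbr i) *m
      (invmx (hessian P i (nbr i :\ j)) *m (matA [set i; j] i)^T)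
    = 2%:R *: (matA [set i; j] i)^T.
Proof.
move=> ij; have [uH PE] := recursive_metric_arc ij.
have /hPpd/pdmx_unit uP : [set i; j] \in edges q by case/andP: ij.
rewrite (hessian_arc ij) mulmxDl (mulKVmx uH).
rewrite -!mulmxA [matA _ _ *m (_ *m _)]mulmxA.
by rewrite -PE mulVmx // mulmx1 scaler_nat mulr2n.
Qed.

(** A vector in the kernel of the sum of two positive semidefinite matrices is
    in the kernel of each, and the recursion asserts that one of them is
    invertible. *)
Lemma hessian_unit (i j : node q) : arc r i j -> hessian P i (nbr i) \in unitmx.
Proof.
move=> ij; have [uH PE] := recursive_metric_arc ij.
have psd' := psdmx_hessian (subD1set (nbr i) j).
apply: unitmx_ker => x Hx0.
rewrite -[x](mulKmx uH) (psdmx_kernel psd' _) ?mulmx0 //.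
have /hPpd pdP : [set i; j] \in edges q by case/andP: ij.
have [_ /(_ x)] := psdmx_congr (matA [set i; j] i) (psdmx_inv pdP).
have [_ /(_ x)] := psd'; rewrite !qform_dot => h1 h2.
have : dot x (hessian P i (nbr i) *m x) = 0 by rewrite Hx0 dot0r.
by rewrite (hessian_arc ij) mulmxDl dotDr; lra.
Qed.

Lemma metric_half (i j : node q) : arc r i j ->
  2%:R *: (matA [set i; j] i *m invmx (hessian P i (nbr i))
             *m (matA [set i; j] i)^T)
    = P [set i; j].
Proof.
move=> ij; have [uH PE] := recursive_metric_arc ij.
rewrite scalemxAr -(hessian_double ij) -mulmxA (mulKmx (hessian_unit ij)).
by rewrite mulmxA -PE.
Qed.

(** For [S = nbr i] this is the linear coefficient of the local objective;
    leaving out the parent gives what [i] knows in the forward stage. *)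
Definition pull (mu : messages q) (i : node q) (S : {set node q}) :
    'cV[R]_(ndim i) :=
  veca i + \sum_(u in S)
    (matA [set i; u] i)^T *m invmx (P [set i; u]) *m mu [set i; u] u.

Lemma local_obj_quad (mu : messages q) (i : node q) (x : 'cV[R]_(ndim i)) :
  local_obj P mu x = quad (hessian P i (nbr i)) (pull mu i (nbr i)) x +
    \sum_(u in nbr i) 2^-1 * wnorm2 (invmx (P [set i; u])) (mu [set i; u] u).
Proof.
rewrite /local_obj quad_shift /quad qform_dot /hessian mulmxDl dotDr mulmx_suml.
rewrite dot_sumr dot_suml mulrDr mulr_sumr /nodef qform_dot.
rewrite -!addrA; congr (_ + _); rewrite addrCA; congr (_ + _).
rewrite -sumrN -!big_split /=; apply: eq_bigr => u /nbr_edge/hPpd pdP.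
have [symP _] := psdmx_inv pdP.
rewrite /wnorm2 !qform_dot -!mulmxA [dot (_^T *m _) x]dot_mulmxl trmxK.
rewrite -(dot_mulmxl (matA _ i) x).
set K := invmx _ in symP *; set m := mu _ _; set y := matA _ _ *m x.
have swap : dot m (K *m y) = dot (K *m m) y by rewrite dot_mulmxl symP.
rewrite mulmxBr !(dotDl, dotDr, dotNl, dotNr) swap (dotC (K *m m)).
lra.
Qed.

Lemma local_argminP (mu : messages q) (i : node q) (x : 'cV[R]_(ndim i)) :
  local_argmin P mu x <-> hessian P i (nbr i) *m x = pull mu i (nbr i).
Proof.
rewrite -(quad_min _ _ (psdmx_hessian (subxx _))) /local_argmin.
by split=> min_x y; have := min_x y; rewrite !local_obj_quad lerD2r.
Qed.

Lemma pull_arc (mu : messages q) (i j : node q) : arc r i j ->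
  pull mu i (nbr i) = pull mu i (nbr i :\ j) +
    (matA [set i; j] i)^T *m invmx (P [set i; j]) *m mu [set i; j] j.
Proof.
case/andP=> ij _; rewrite /pull (big_setD1 j) ?inE //=.
by rewrite [X in _ + X]addrC addrA.
Qed.

(** Solve the stationarity condition at [i] for [x]: by [metric_half] the
    message from [j] enters [2 A x] with coefficient one. So the forward
    formula, in which that message is absent, equals an expression in the
    local minimiser. *)
Lemma forward_formula (mu : messages q) (i j : node q) (x : 'cV[R]_(ndim i)) :
  arc r i j -> local_argmin P mu x ->
  2%:R *: (matA [set i; j] i *m invmx (hessian P i (nbr i))
             *m pull mu i (nbr i :\ j))
    = 2%:R *: (matA [set i; j] i *m x) - mu [set i; j] j.
Proof.
move=> ij /local_argminP; rewrite (pull_arc _ ij).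
move: (pull _ _ (_ :\ _)) => w Hx.
have /hPpd/pdmx_unit uP : [set i; j] \in edges q by case/andP: ij.
rewrite -[x in RHS](mulKmx (hessian_unit ij)) Hx mulmxA mulmxDr scalerDr.
rewrite !mulmxA [2%:R *: (_ *m mu _ _)]scalemxAl.
rewrite [2%:R *: (_ *m invmx (P _))]scalemxAl (metric_half ij).
by rewrite mulmxV // mul1mx addrK.
Qed.

(** By feasibility, [vecc e - matA e v *m x v] is the image of [x] at the other
    end of [e], so that this is the message [A_{i|j} x_i + P_ij delta_ij] from
    [v = j] to [i], written in terms of its sender only. *)
Definition kkt_messages (x : point q) (delta : multiplier q) : messages q :=
  fun e v => P e *m delta e + (vecc e - matA e v *m x v).

Lemma kkt_fixed_messages (x : point q) (delta : multiplier q) :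
  kkt x delta -> fixed_messages r P (kkt_messages x delta).
Proof.
move=> [feas stat]; set mu := kkt_messages x delta.
have incoming (i u : node q) : adj i u ->
    mu [set i; u] u = P [set i; u] *m delta [set i; u] + matA [set i; u] i *m x i.
  by move=> iu; rewrite /mu /kkt_messages -(feas _ _ iu) addrK.
have argmin i : local_argmin P mu (x i).
  apply/local_argminP; rewrite /hessian /pull mulmxDl stat /tension -addrA.
  congr (_ + _); rewrite mulmx_suml -big_split; apply: eq_bigr => u iu /=.
  have uP := pdmx_unit (hPpd (nbr_edge iu)).
  rewrite incoming; last by rewrite inE in iu.
  by rewrite mulmxDr -!mulmxA (mulKmx uP).
split=> [i j ij|i].
  have adj_ij : adj i j by case/andP: ij.
  rewrite -/(pull mu i (nbr i :\ j)) (forward_formula ij (argmin i)).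
  rewrite incoming // {1}/mu /kkt_messages.
  move: (P _ *m _) (matA _ _ *m _) (vecc _) => a b c.
  by apply/colP => k; rewrite !mxE; ring.
exists (x i); split=> // u /andP[]; rewrite adj_sym => iu _.
rewrite incoming // {1}/mu /kkt_messages.
move: (P _ *m _) (matA _ _ *m _) (vecc _) => a b c.
by apply/colP => k; rewrite !mxE; ring.
Qed.

Section FixedPoint.

Variable mu : messages q.
Hypothesis mu_fixed : fixed_messages r P mu.
Variable x : point q.
Hypothesis x_argmin : forall i, local_argmin P mu (x i).
Hypothesis x_reflected : forall i, reflected r mu (x i).

(** Towards the root the identity is the forward formula, away from the root it
    is the backward formula; after this the orientation of the edges no longer
    matters ([message_gap]). *)
Lemma message_gap_arc (i j : node q) : arc r i j ->
  2%:R *: (matA [set i; j] i *m x i) =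
    vecc [set i; j] - mu [set i; j] i + mu [set i; j] j /\
  2%:R *: (matA [set i; j] j *m x j) =
    vecc [set i; j] - mu [set i; j] j + mu [set i; j] i.
Proof.
move=> ij; split.
  have [/(_ _ _ ij) + _] := mu_fixed.
  rewrite -/(pull mu i (nbr i :\ j)) (forward_formula ij (@x_argmin i)) => ->.
  move: (2%:R *: _) (mu _ _) (vecc _) => a b c.
  by apply/colP => k; rewrite !mxE; ring.
have := @x_reflected j i ij; rewrite setUC => ->.
move: (2%:R *: _) (mu _ _) (vecc _) => a b c.
by apply/colP => k; rewrite !mxE; ring.
Qed.

Lemma message_gap (i j : node q) : adj i j ->
  2%:R *: (matA [set i; j] i *m x i) =
    vecc [set i; j] - mu [set i; j] i + mu [set i; j] j.
Proof.
case/(adj_arc htree r)/orP => /message_gap_arc[] // _.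
by rewrite setUC.
Qed.

(** The two ends of an edge give [P^-1 (m_{j -> i} - A_{i|j} x_i)] and
    [P^-1 (m_{i -> j} - A_{j|i} x_j)] for its multiplier; their mean depends on
    the edge only and, by feasibility, no longer on [x]. *)
Definition message_multiplier : multiplier q :=
  fun e => invmx (P e) *m (2^-1 *: (\sum_(v in e) mu e v - vecc e)).

Lemma fixed_point_kkt : kkt x message_multiplier.
Proof.
have [card_edges _ _] := htree.
have two_neq0 : 2%:R != 0 :> R by rewrite pnatr_eq0.
split=> [i j ij|i].
  apply: (scalerI two_neq0); rewrite scalerDr message_gap //.
  have := @message_gap j i; rewrite adj_sym setUC => -> //.
  move: (mu _ i) (mu _ j) (vecc _) => a b c.
  by apply/colP => k; rewrite !mxE; ring.
have /local_argminP := @x_argmin i.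
rewrite /hessian /pull /tension mulmxDl => /(canRL (addrK _)) ->.
rewrite -addrA mulmx_suml -sumrB; congr (_ + _); apply: eq_bigr => u iu.
rewrite inE in iu; rewrite /message_multiplier (sum_edge card_edges) //.
rewrite -!mulmxA -!mulmxBr; congr (_ *m (_ *m _)).
have := message_gap iu => /(canRL (scalerK two_neq0)) ->.
move: (mu _ i) (mu _ u) (vecc _) => a b c.
by apply/colP => k; rewrite !mxE; field.
Qed.

End FixedPoint.

(** * Uniqueness of the optimal point *)

Lemma dist_root : dist r r = 0%N.
Proof. exact: (dist_path (p := [::]) htree). Qed.

Lemma dist_le (i : node q) : (dist i r <= nnodes q)%N.
Proof. by rewrite -[leqRHS](size_iota 0) find_size. Qed.

(** Away from the root the inverses in the recursion force a direction that is
    flat for the objective and tangent to the constraints to vanish, starting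
    from the leaves; at the root the recursion takes no inverse, whence the
    first hypothesis. *)
Lemma flat_tangent_eq0 (d : point q) :
  (forall v : 'cV_(ndim r), hessian P r (nbr r) *m v = 0 -> v = 0) ->
  (forall i, Sigma i *m d i = 0) ->
  (forall i j, adj i j ->
     matA [set i; j] i *m d i + matA [set i; j] j *m d j = 0) ->
  forall i, d i = 0.
Proof.
move=> root_inj flat tangent i.
(* The measure decreases from a node to its children, so the induction
   proceeds from the leaves to the root. *)
have [n] := ubnP (nnodes q - dist i r)%N; elim: n i => // n IHn i le_n.
have flat_hessian (S : {set node q}) :
    (forall u, u \in S -> arc r u i) -> hessian P i S *m d i = 0.
  move=> S_child; rewrite /hessian mulmxDl flat add0r mulmx_suml big1 // => u.
  case/S_child/andP=> ui lt_iu; rewrite -mulmxA (_ : matA _ i *m d i = 0).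
    by rewrite mulmx0.
  have := tangent _ _ ui; rewrite setUC IHn ?mulmx0 ?add0r //.
  rewrite -ltnS; apply: leq_trans le_n.
  by rewrite ltnS ltn_sub2l // (leq_trans lt_iu) ?dist_le.
have [ir|/(arc_parent_exists htree)[j ij]] := eqVneq i r.
  rewrite ir in flat_hessian *; apply/root_inj/flat_hessian => u.
  rewrite inE => /(adj_arc htree r)/orP[/andP[_]|//].
  by rewrite dist_root.
have [uH _] := recursive_metric_arc ij.
rewrite -[d i](mulKmx uH) flat_hessian ?mulmx0 // => u.
exact: arc_child htree _ _ _ _ ij.
Qed.

(** Uniqueness of the minimiser at the root means that the Hessian there is
    injective, as adding a kernel vector to a minimiser gives another one. *)
Lemma optimal_unique (mu : messages q) (x y : point q) (delta : multiplier q) :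
  (forall u v : 'cV[R]_(ndim r),
     local_argmin P mu u -> local_argmin P mu v -> u = v) ->
  local_argmin P mu (x r) -> kkt x delta -> is_optimal y ->
  forall i, x i = y i.
Proof.
move=> root_unique x_min kkt_x opt_y i; have [card_edges _ _] := htree.
have [feas_y flat] := optimal_diff card_edges hSigma kkt_x opt_y.
apply/esym/eqP; rewrite -subr_eq0; apply/eqP.
apply: (@flat_tangent_eq0 (fun k => y k - x k)) => // [v Hv|j k jk].
  apply: (addrI (x r)); rewrite addr0; apply: root_unique => //.
  by apply/local_argminP; rewrite mulmxDr Hv addr0; apply/local_argminP.
have [feas_x _] := kkt_x.
by rewrite !mulmxBr addrACA -opprD feas_x // feas_y // subrr.
Qed.

(** * Termination of the runs *)

Section Runs.

Variable mu : messages q.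
Hypothesis mu_fixed : fixed_messages r P mu.

Definition consistent (s : state q) : Prop :=
  [/\ arcs_done s \subset arcs r,
      forall i j, (i, j) \in arcs_done s -> mhat s [set i; j] i = mu [set i; j] i,
      forall i, i \in nodes_done s ->
        local_argmin P mu (xhat s i) /\ reflected r mu (xhat s i)
    & forall i u, i \in nodes_done s -> arc r u i ->
        mhat s [set i; u] i = mu [set i; u] i].

Definition finished (s : state q) : bool :=
  (arcs_done s == arcs r) && (nodes_done s == setT).

Definition progress (s : state q) : nat := (#|arcs_done s| + #|nodes_done s|)%N.

(** Steps only ever write converged values, so a correct message stays
    correct. *)
Lemma step_messages s s' : pdmm_step r P mu s s' ->
  forall e v, mhat s' e v = mhat s e v \/ mhat s' e v = mu e v.
Proof.
case=> [[i [j [_ _ new old _]]]|[i [_ _ _ [_ _ new _ old] _]]] e v.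
  have [[-> ->]|/eqP ev] := eqVneq (e, v) ([set i; j], i); first by right.
  by left; apply: old.
have [/andP[/eqP-> /existsP[u /andP[ui /eqP->]]]|ev] :=
    boolP ((v == i) && [exists u, arc r u i && (e == [set i; u])]).
  by right; apply: new.
left; apply: old => -[vi [u ui eu]]; case/negP: ev.
by rewrite vi eqxx; apply/existsP; exists u; rewrite ui eu eqxx.
Qed.

Lemma step_consistent s s' :
  pdmm_step r P mu s s' -> consistent s -> consistent s'.
Proof.
move=> step [sub arcs_ok argmin_ok nodes_ok].
have keep e v : mhat s e v = mu e v -> mhat s' e v = mu e v.
  by move=> ok; case: (step_messages step e v) => ->.
case: step => [[i [j [ij _ new _ [x_eq arcs_eq nodes_eq]]]]|].
  split.
  - rewrite arcs_eq subUset sub andbT sub1set.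
    by move: ij; rewrite inE => /andP[].
  - move=> k l; rewrite arcs_eq inE => /orP[|/arcs_ok/keep//].
    by rewrite inE => /eqP[-> ->].
  - by move=> k; rewrite nodes_eq x_eq; apply: argmin_ok.
  - by move=> k u; rewrite nodes_eq => kd uk; apply/keep/nodes_ok.
case=> i [arcs_all i_new _ [x_min x_refl new x_old _] [arcs_eq nodes_eq]].
split.
- by rewrite arcs_eq.
- by move=> k l; rewrite arcs_eq => /arcs_ok/keep.
- move=> k; rewrite nodes_eq !inE; have [->//|/eqP ki /=] := eqVneq k i.
  by rewrite x_old //; apply: argmin_ok.
- move=> k u; rewrite nodes_eq !inE => /orP[/eqP->|kd uk]; first exact: new.
  exact/keep/nodes_ok.
Qed.

Lemma step_progress s s' :
  pdmm_step r P mu s s' -> progress s' = (progress s).+1.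
Proof.
case=> [[i [j [ij _ _ _ [_ arcs_eq nodes_eq]]]]|
        [i [_ i_new _ _ [arcs_eq nodes_eq]]]].
  rewrite /progress arcs_eq nodes_eq cardsU1; move: ij.
  by rewrite inE => /andP[-> _].
by rewrite /progress arcs_eq nodes_eq cardsU1 i_new addnCA.
Qed.

Lemma progress_bound s : consistent s -> (progress s <= #|arcs r| + #|node q|)%N.
Proof.
by case=> sub _ _ _; apply: leq_add; [apply: subset_leq_card | apply: max_card].
Qed.

Lemma step_unfinished s s' : pdmm_step r P mu s s' -> ~~ finished s.
Proof.
case=> [[i [j [ij _ _ _ _]]]|[i [_ i_new _ _ _]]]; apply/andP => -[/eqP a /eqP n].
  by move: ij; rewrite a setDv inE.
by rewrite n inE in i_new.
Qed.

(** Take an unprocessed edge farthest from the root: the edges from the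
    children of its tail lie farther away, hence are processed. *)
Lemma forward_possible s : consistent s -> arcs_done s != arcs r ->
  exists s', pdmm_step r P mu s s'.
Proof.
case=> sub arcs_ok _ _ todo.
have [b0 b0_todo] : exists b, b \in arcs r :\: arcs_done s.
  apply/set0Pn; apply: contra todo => /eqP empty.
  by rewrite eqEsubset sub /= -setD_eq0 empty.
case: (arg_maxnP (P := fun b => b \in arcs r :\: arcs_done s)
  (fun b => dist b.1 r) b0_todo) => -[i j] /=.
move=> ij_todo far.
have ij : arc r i j by move: ij_todo; rewrite !inE => /andP[].
exists (State (xhat s)
  (fun e v => if (e, v) == ([set i; j], i) then mu e v else mhat s e v)
  ((i, j) |: arcs_done s) (nodes_done s)).
left; exists i, j; split=> //=.
- move=> u u_child; have ui := arc_child htree ij u_child.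
  rewrite setUC; apply: arcs_ok; apply/negPn/negP => u_todo.
  have /far /= : (u, i) \in arcs r :\: arcs_done s by rewrite !inE u_todo.
  by rewrite leqNgt; case/andP: ui => _ ->.
- by rewrite eqxx.
- by move=> e v /eqP/negPf ->.
Qed.

(** Take an unprocessed node nearest to the root: its parent is processed, and
    its children have sent their messages in the forward stage. *)
Lemma backward_possible s : consistent s -> arcs_done s = arcs r ->
  nodes_done s != setT -> exists s', pdmm_step r P mu s s'.
Proof.
case=> _ arcs_ok _ nodes_ok all_arcs todo.
have [i0 i0_todo] : exists i, i \in ~: nodes_done s.
  by apply/set0Pn; apply: contra todo; rewrite -setCT => /eqP/setC_inj->.
case: (arg_minnP (P := fun i => i \in ~: nodes_done s)
  (fun i => dist i r) i0_todo) => i /=.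
rewrite inE => i_todo near; have [_ /(_ i)[x [x_min x_refl]]] := mu_fixed.
exists (State (dfwith (xhat s) x)
  (fun e v => if (v == i) && [exists u, arc r u i && (e == [set i; u])]
              then mu e v else mhat s e v)
  (arcs_done s) (i |: nodes_done s)).
right; exists i; split=> //=.
- move=> u; rewrite inE => iu; case/orP: (adj_arc htree r iu) => [pu|ui].
    rewrite setUC; apply: (nodes_ok _ _ _ pu); apply/negPn/negP => u_todo.
    have /near : u \in ~: nodes_done s by rewrite inE.
    by rewrite leqNgt; case/andP: pu => _ ->.
  by rewrite setUC; apply: arcs_ok; rewrite all_arcs inE.
- rewrite dfwith_in; split=> //.
  + move=> u ui; rewrite eqxx /= ifT //.
    by apply/existsP; exists u; rewrite ui eqxx.
  + by move=> v /eqP vi; rewrite dfwith_out // eq_sym.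
  + move=> e v old; rewrite ifF //; apply/negP => /andP[/eqP vi].
    by case/existsP=> u /andP[ui /eqP eu]; apply: old; split=> //; exists u.
Qed.

Lemma step_possible s : consistent s -> ~~ finished s ->
  exists s', pdmm_step r P mu s s'.
Proof.
move=> ok; rewrite negb_and.
have [all_arcs|todo] := eqVneq (arcs_done s) (arcs r).
  exact: backward_possible.
by move=> _; apply: forward_possible.
Qed.

Variable s : nat -> state q.
Hypothesis run : pdmm_run r P mu s.

Lemma run_consistent k : consistent (s k).
Proof.
have [arcs0 nodes0 next] := run; elim: k => [|k IHk].
  rewrite /consistent arcs0 nodes0.
  by split=> [|i j|i|i u]; rewrite ?sub0set // inE.
by case: (next k) => [/step_consistent|[_ ->]]; last exact: IHk; apply.
Qed.

Lemma run_finishes : exists N, finished (s N).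
Proof.
have [arcs0 nodes0 next] := run.
have grow k : (exists N, finished (s N)) \/ (k <= progress (s k))%N.
  elim: k => [|k [IHk|IHk]]; [by right|by left|].
  have [fin|unfin] := boolP (finished (s k)); first by left; exists k.
  case: (next k) => [/step_progress ->|[stuck _]]; first by right.
  by case: stuck; apply: step_possible unfin; apply: run_consistent.
case: (grow (#|arcs r| + #|node q|).+1) => // too_far.
have := leq_trans too_far (progress_bound (run_consistent _)).
by rewrite ltnn.
Qed.

Lemma finished_stays N k : finished (s N) -> (N <= k)%N -> s k = s N.
Proof.
move=> fin /subnK <-; have [_ _ next] := run.
elim: (k - N)%N => //= n IHn; rewrite addSn.
case: (next (n + N)%N) => [/step_unfinished|[_ ->//]].
by rewrite IHn fin.
Qed.

Lemma run_converges : exists x : point q,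
  [/\ forall i, local_argmin P mu (x i), forall i, reflected r mu (x i)
    & finitely_converges r s x].
Proof.
have [N fin] := run_finishes; exists (xhat (s N)).
have [_ _ ok _] := run_consistent N.
case/andP: (fin) => /eqP arcs_all /eqP nodes_all.
split=> [i|i|]; try by apply: (ok i _).1; rewrite nodes_all inE.
  by have [] := ok i; rewrite ?nodes_all ?inE.
by exists N; split=> // k Nk i; rewrite (finished_stays fin Nk).
Qed.

End Runs.

End Messages.

Theorem theorem4 (R : realType) (q : quad_network R) (r : node q)
    (P : metric q)
    (htree : is_tree q)
    (hSigma : forall i : node q, psdmx (Sigma i))
    (hsaddle : exists (x : point q) (delta : multiplier q),
       saddle_point x delta)
    (hPrec : recursive_metric r P)
    (hPpd : forall e, e \in edges q -> pdmx (P e)) :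
  (exists mu : messages q, fixed_messages r P mu) /\
  (forall (mu : messages q) (s : nat -> state q),
     fixed_messages r P mu -> pdmm_run r P mu s ->
     (exists xstar : point q,
        is_optimal xstar /\ finitely_converges r s xstar) /\
     ((forall x y : 'cV[R]_(ndim r),
         local_argmin P mu x -> local_argmin P mu y -> x = y) ->
      forall xstar : point q,
        is_optimal xstar -> finitely_converges r s xstar)).
Proof.
have [card_edges _ _] := htree.
split=> [|mu s mu_fixed run].
  have [x [delta /(saddle_kkt card_edges hSigma) kkt_x]] := hsaddle.
  by exists (kkt_messages P x delta); apply: kkt_fixed_messages.
have [x [x_min x_refl conv]] := run_converges htree mu_fixed run.
have kkt_x := fixed_point_kkt htree hSigma hPrec hPpd mu_fixed x_min x_refl.
split; first by exists x; split=> //; apply: kkt_optimal kkt_x.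
move=> root_unique y opt_y; have [N [arcs_all nodes_all xhat_eq]] := conv.
exists N; split=> // k Nk i; rewrite xhat_eq //.
exact: (optimal_unique htree hSigma hPrec hPpd root_unique _ kkt_x opt_y).
Qed.
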